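(* For every constant $c>0$ there exist a constant $c'>0$, an integer $n_0$, and a function $\eta:\mathbb{N}\to[0,1]$ with $\eta(n)\to 0$ as $n\to\infty$, such that the following holds. For every $n\ge n_0$ and every integer $\Delta$ with $\Delta\ge c\log n$, $\Delta<n$ and $n\Delta$ even, there exists a $\Delta$-regular graph $G$ on $n$ vertices such that, when $n$ requests are sampled independently and uniformly at random from the edges of $G$, every online algorithm has, with probability at least $1-\eta(n)$, $$\max_{t\le n}\|d_t\|_\infty\ge c'\Big(\frac{\log n}{\log\Delta}\Big)^{1/3}.$$
   Context: Online carpooling with unit weights: the discrepancy vector starts at $d_0=0\in\mathbb{R}^n$. At time $t$ an edge $e_t=\{i_t,j_t\}$ of $G$ is revealed, and the algorithm must immediately and irrevocably choose a sign $\epsilon_t\in\{-1,1\}$ (an orientation of the edge) based only on the edges $e_1,\ldots,e_t$ revealed so far (and possibly on internal randomness independent of the requests); then $d_t=d_{t-1}+\epsilon_t(\mathbf{1}(i_t)-\mathbf{1}(j_t))$, where $\mathbf{1}(i)$ is the $i$-th standard basis vector. The conditions $\Delta<n$ and $n\Delta$ even are equivalent to the existence of a $\Delta$-regular graph on $n$ vertices. *)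

(* Defs.v *)
From HB Require Import structures.
From mathcomp Require Import all_boot all_order all_algebra.
From mathcomp Require Import all_classical all_reals all_analysis.

Set Implicit Arguments.
Unset Strict Implicit.
Unset Printing Implicit Defensive.

Import Order.TTheory GRing.Theory Num.Theory.
Import numFieldNormedType.Exports.

Local Open Scope classical_set_scope.
Local Open Scope ring_scope.

Definition simple_graph (n : nat) (g : rel 'I_n) : Prop :=
  symmetric g /\ irreflexive g.

Definition regular_graph (n : nat) (g : rel 'I_n) (k : nat) : Prop :=
  forall v : 'I_n, #|[set w | g v w]%SET| = k.

(* The edge {i, j} is encoded by the pair (i, j) with i < j. This fixes the
   orientation to which the sign chosen by an algorithm refers. *)
Definition edge_set (n : nat) (g : rel 'I_n) : {set 'I_n * 'I_n} :=
  [set p : 'I_n * 'I_n | (p.1 < p.2)%N && g p.1 p.2]%SET.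

(* [alg h] is the decision after the revealed edges [h], in order of arrival
   and including the current one; [true] stands for -1 and [false] for +1.
   Time starts at 0: the request [r t] leads from d_t to d_{t+1}. *)
Fixpoint discrepancy (R : realType) (n : nat) (alg : seq ('I_n * 'I_n) -> bool)
    (r : nat -> 'I_n * 'I_n) (t : nat) : 'rV[R]_n :=
  match t with
  | 0%N => 0
  | t'.+1 => discrepancy R alg r t' +
      (-1) ^+ alg (mkseq r t'.+1) *:
        (delta_mx 0 (r t').1 - delta_mx 0 (r t').2)
  end.

(* [`|v|] is the sup norm on ['rV[R]_n]. *)
Definition max_discrepancy (R : realType) (n : nat)
    (alg : seq ('I_n * 'I_n) -> bool) (r : nat -> 'I_n * 'I_n) (T : nat) : R :=
  \big[Num.max/0]_(t < T.+1) `|discrepancy R alg r t|.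

Definition mutually_independent (R : realType) (d : measure_display)
    (Omega : measurableType d) (P : probability Omega R)
    (I : finType) (F : I -> set (set Omega)) : Prop :=
  forall (J : {set I}) (A : I -> set Omega),
    (forall i, i \in J -> F i (A i)) ->
    P (\bigcap_(i in [set` J]) A i) = (\prod_(i in J) P (A i))%E.

(* The first [m] requests are independent and uniform on [E], and independent
   of the seed [U]. The value type of the requests is finite and carries its
   discrete sigma-algebra, hence the [setT] in their generated sigma-algebras. *)
Definition iid_uniform_requests (R : realType) (d d' : measure_display)
    (Omega : measurableType d) (S : measurableType d')
    (P : probability Omega R) (V : finType) (E : {set V}) (m : nat)
    (X : nat -> Omega -> V) (U : Omega -> S) : Prop :=
  [/\ forall (t : 'I_m) (A : set V), measurable (X t @^-1` A),
      forall (t : 'I_m) (e : V),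
        P (X t @^-1` [set e]) = ((e \in E)%:R / #|E|%:R)%:E
    & mutually_independent P (fun o : option 'I_m =>
        if o is Some t then preimage_set_system setT (X t) setT
        else preimage_set_system setT U measurable)].

(* A randomized online algorithm reads a random seed and the revealed edges;
   each of its decisions is a measurable function of the seed. *)
Definition online_algorithm (d : measure_display) (S : measurableType d)
    (n : nat) (alg : S -> seq ('I_n * 'I_n) -> bool) : Prop :=
  forall h, measurable_fun setT (fun s => alg s h).

(* Main.v *)
Require Import Defs.
From HB Require Import structures.
From mathcomp Require Import all_boot all_order all_algebra.
From mathcomp Require Import all_classical all_reals all_analysis.
From mathcomp Require Import measurable_realfun zify ring lra.

(* In a clique [W] of [2j] vertices whose discrepancies are all below [j] in
   absolute value, two vertices share the same discrepancy; requesting the edge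
   between them increases the sum of [d_v ^ 2] over [W] by exactly 2, whatever
   the algorithm answers.  Hence [j ^ 3] such requests force a discrepancy [j].

   The graph is a circulant: [Theta(n / Delta)] windows of [2j] consecutive
   vertices are cliques, and no edge joins two windows.  While a window is not
   touched by other edges, each step requests the wanted edge with probability
   [1 / |E|], so one window succeeds with probability [Delta ^ (- O(j ^ 3))],
   which is at least [n ^ (-1/2)] for [j ~ c' (ln n / ln Delta) ^ (1/3)].

   The windows are not independent, since the algorithm sees all requests.
   But a request touches at most one window, so the product over the windows
   of the failure probabilities is a supermartingale, and all windows fail with
   probability at most [(1 - p) ^ m]. *)

Import Order.TTheory GRing.Theory Num.Theory.
Import numFieldNormedType.Exports.

Set Implicit Arguments.
Unset Strict Implicit.
Unset Printing Implicit Defensive.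

Local Open Scope ring_scope.

(** * Success probability of one window *)

(* The probability that, within [t] steps, [l] wanted requests come before any
   other request touching the window: a step brings the wanted request with
   probability [s], and some request touching the window with probability [q]. *)
Fixpoint hit_prob (R : realFieldType) (s q : R) (t l : nat) : R :=
  if l is l'.+1 then
    if t is t'.+1 then (1 - q) * hit_prob s q t' l + s * hit_prob s q t' l'
    else 0
  else 1.

Lemma hit_prob0 (R : realFieldType) (s q : R) t : hit_prob s q t 0 = 1.
Proof. by case: t. Qed.

Lemma hit_prob_ge0 (R : realFieldType) (s q : R) t l :
  0 <= s -> q <= 1 -> 0 <= hit_prob s q t l.
Proof.
move=> s0 q1; elim: t l => [|t IH] [|l] //=.
by rewrite addr_ge0 ?mulr_ge0 ?subr_ge0.
Qed.

Lemma hit_prob_le1 (R : realFieldType) (s q : R) t l :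
  0 <= s -> s <= q -> q <= 1 -> hit_prob s q t l <= 1.
Proof.
move=> s0 sq q1; elim: t l => [|t IH] [|l] //=.
have q1' : 0 <= 1 - q by rewrite subr_ge0.
have := ler_wpM2l q1' (IH l.+1); have := ler_wpM2l s0 (IH l).
by lra.
Qed.

(* Being touched lowers the success probability of a window on average, so all
   factors of the potential in [avoid_prob_le] move in the same direction. *)
Lemma hit_prob_hit (R : realFieldType) (s q : R) t l :
  0 <= s -> 0 <= q -> q <= 1 ->
  q * hit_prob s q t l.+1 <= s * hit_prob s q t l.
Proof.
move=> s0 q0 q1; have q1' : 0 <= 1 - q by rewrite subr_ge0.
elim: t l => [|t IH] l /=.
  by rewrite mulr0 mulr_ge0 //; case: l.
rewrite mulrDr mulrCA [q * (s * _)]mulrCA.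
case: l => [|l].
  rewrite hit_prob0 !mulr1; have := ler_wpM2l q1' (IH 0%N).
  by rewrite hit_prob0; lra.
have := ler_wpM2l q1' (IH l.+1); have := ler_wpM2l s0 (IH l).
by move=> /= h1 h2; rewrite mulrDr lerD // [s * (_ * _)]mulrCA.
Qed.

Lemma hit_prob_mono (R : realFieldType) (s q : R) t t' l :
  0 <= s -> 0 <= q -> q <= 1 -> (t <= t')%N ->
  hit_prob s q t l <= hit_prob s q t' l.
Proof.
move=> s0 q0 q1 /subnK <-; elim: (_ - _)%N => [|k IH] //.
apply: le_trans IH _; rewrite addSn; case: l => [|l] /=; first by rewrite hit_prob0.
by have := hit_prob_hit (k + t) l s0 q0 q1; lra.
Qed.

(** Keep only the runs with [l] wanted requests at prescribed positions and no other touch. The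
    exponent [t] in place of [t - l] only weakens the bound and lets Pascal's rule drive the
    induction. *)
Lemma hit_prob_ge (R : realFieldType) (s q : R) t l :
  0 <= s -> 0 <= q -> q <= 1 ->
  'C(t, l)%:R * s ^+ l * (1 - q) ^+ t <= hit_prob s q t l.
Proof.
move=> s0 q0 q1; have q1' : 0 <= 1 - q by rewrite subr_ge0.
have q1'' : 1 - q <= 1 by lra.
elim: t l => [|t IH] [|l] /=.
- by rewrite bin0 !expr0 !mulr1.
- by rewrite bin0n !mul0r.
- by rewrite bin0 expr0 !mul1r exprn_ile1.
rewrite binS natrD [_ * s ^+ _]mulrDl [leLHS]mulrDl lerD //.
  rewrite [(1 - q) ^+ t.+1]exprS mulrCA.
  by rewrite ler_wpM2l.
apply: le_trans (ler_wpM2l s0 (IH l)).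
rewrite !exprS; set X := s ^+ l; set Y := _ ^+ t; set C := _%:R.
rewrite [leLHS](_ : _ = (1 - q) * (s * (C * X * Y))); last by ring.
by rewrite ler_piMl // !mulr_ge0 ?exprn_ge0.
Qed.

(** A Weierstrass product inequality. It decouples the windows in [avoid_prob_le], where [b i] is a
    failure probability and [y i] its decrease when one more step is available. *)
Lemma prodr_sub_ge (R : realFieldType) (m : nat) (b y : 'I_m -> R) :
  (forall i, 0 <= y i <= b i) ->
  \prod_i b i - \sum_i y i * \prod_(k | k != i) b k <= \prod_i (b i - y i).
Proof.
elim: m b y => [|m IH] b y hy; first by rewrite !big_ord0 subr0.
have /IH := fun i => hy (lift ord0 i).
set B := \prod_i b _; set Y := \prod_i (b _ - y _); set Z := \sum_i _ => h.
have -> : \sum_i y i * \prod_(k | k != i) b k = y ord0 * B + b ord0 * Z.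
  rewrite big_ord_recl; congr (_ * _ + _).
    by rewrite big_mkcond big_ord_recl /= mul1r.
  rewrite big_distrr /=; apply: eq_bigr => i _.
  rewrite mulrCA [in LHS]big_mkcond big_ord_recl /=; congr (_ * (_ * _)).
  by rewrite [RHS]big_mkcond.
rewrite !big_ord_recl -/B -/Y.
have /andP[y0 yb] := hy ord0.
have YB : Y <= B.
  by apply: ler_prod => i _; have /andP[? ?] := hy (lift ord0 i); lra.
have h1 : b ord0 * (B - Z) <= b ord0 * Y by rewrite ler_wpM2l // (le_trans y0).
have h2 : y ord0 * Y <= y ord0 * B by rewrite ler_wpM2l.
by lra.
Qed.

(** * Energy of a window *)

(* Histories are stored with the latest request first. *)
Fixpoint disc (n : nat) (alg : seq ('I_n * 'I_n) -> bool)
    (h : seq ('I_n * 'I_n)) (u : 'I_n) : int :=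
  if h is e :: h' then
    disc alg h' u + (-1) ^+ alg (rev h) * ((u == e.1)%:Z - (u == e.2)%:Z)
  else 0.

Definition peak n (alg : seq ('I_n * 'I_n) -> bool) (k : nat) h :=
  [exists u, (k < `|disc alg h u|)%N].

Definition energy n (alg : seq ('I_n * 'I_n) -> bool) (W : {set 'I_n}) h : nat :=
  (\sum_(u in W) `|disc alg h u| ^ 2)%N.

Definition touches n (W : {set 'I_n}) (e : 'I_n * 'I_n) : bool :=
  (e.1 \in W) || (e.2 \in W).

Lemma energy_untouched n (alg : seq ('I_n * 'I_n) -> bool) W h e :
  ~~ touches W e -> energy alg W (e :: h) = energy alg W h.
Proof.
rewrite negb_or => /andP[e1 e2]; apply: eq_bigr => u uW /=.
have /negbTE -> : u != e.1 by apply: contraNneq e1 => <-.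
have /negbTE -> : u != e.2 by apply: contraNneq e2 => <-.
by rewrite subrr mulr0 addr0.
Qed.

(** Since (d + 1)^2 + (d - 1)^2 = 2 d^2 + 2, both answers of the algorithm have the same effect. *)
Lemma energy_hit n (alg : seq ('I_n * 'I_n) -> bool) (W : {set 'I_n}) h e :
  e.1 \in W -> e.2 \in W -> e.1 != e.2 -> disc alg h e.1 = disc alg h e.2 ->
  energy alg W (e :: h) = (energy alg W h).+2.
Proof.
move=> e1 e2 ne dd; rewrite /energy.
rewrite (bigD1 e.1 e1) [in RHS](bigD1 e.1 e1) /=.
have e21 : (e.2 \in W) && (e.2 != e.1) by rewrite e2 eq_sym.
rewrite (bigD1 e.2 e21) [in RHS](bigD1 e.2 e21) /=.
under eq_bigr => u /andP[/andP[_ /negbTE ->] /negbTE ->].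
  rewrite subrr mulr0 addr0; over.
rewrite !eqxx [e.2 == e.1]eq_sym (negbTE ne) -dd.
set d := disc alg h e.1; set S := (\sum_(i < n | _) _)%N.
by case: (alg _); rewrite /= ?expr0 ?expr1; nia.
Qed.

(** Each of the 2(k + 1) vertices contributes at most k^2. Hence [k.+1 ^ 3] minus half the energy,
    the number of missing hits, is positive before a peak. *)
Lemma energy_lt n (alg : seq ('I_n * 'I_n) -> bool) (W : {set 'I_n}) k h :
  #|W| = k.+1.*2 -> ~~ peak alg k h -> ((energy alg W h)./2 < k.+1 ^ 3)%N.
Proof.
move=> sz /existsPn np.
have : (energy alg W h <= k.+1.*2 * k ^ 2)%N.
  rewrite -sz -sum_nat_const leq_sum // => u _.
  by rewrite leq_sqr leqNgt np.
rewrite -doubleMl => /half_leq; rewrite doubleK => /leq_ltn_trans -> //.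
by rewrite [ltnRHS]expnS ltn_pmul2l // ltn_sqr.
Qed.

(** Pigeonhole: without a peak, the discrepancies of 2k + 2 vertices lie among the 2k + 1 integers
    from -k to k. *)
Lemma equal_disc n (alg : seq ('I_n * 'I_n) -> bool) (W : {set 'I_n}) k h :
  #|W| = k.+1.*2 -> ~~ peak alg k h ->
  exists e : 'I_n * 'I_n, [/\ e.1 \in W, e.2 \in W, (e.1 < e.2)%N
    & disc alg h e.1 = disc alg h e.2].
Proof.
move=> sz /existsPn np.
pose f u : 'I_(k.*2.+1) := inord (absz (disc alg h u + k%:Z)).
have fE u : f u = absz (disc alg h u + k%:Z) :> nat.
  by rewrite inordK //; have := np u; lia.
have [/dinjectiveP/card_in_imset fW|] := boolP (dinjectiveb f (mem W)).
  by have := max_card (mem (f @: W)); rewrite fW sz card_ord; lia.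
case/dinjectivePn => u uW [v /andP[vu vW] fuv].
have duv : disc alg h u = disc alg h v.
  have := congr1 val fuv; rewrite /= !fE; have := np u; have := np v; lia.
case: (ltngtP u v) => [uv|vu'|/val_inj uv].
- by exists (u, v).
- by exists (v, u).
- by move: vu; rewrite uv ?inE eqxx.
Qed.

(** * Avoidance probability and the potential over the windows *)

Fixpoint avoid_prob (R : realFieldType) n (w : 'I_n * 'I_n -> R)
    (alg : seq ('I_n * 'I_n) -> bool) (k t : nat) h : R :=
  if peak alg k h then 0
  else if t is t'.+1 then \sum_e w e * avoid_prob w alg k t' (e :: h) else 1.

Lemma avoid_prob_peak (R : realFieldType) n (w : 'I_n * 'I_n -> R) alg k t h :
  peak alg k h -> avoid_prob w alg k t h = 0.
Proof. by case: t => [|t] /= ->. Qed.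

(** The right-hand side is a supermartingale along the requests. The factor of a window is its
    failure probability given its missing hits; an unwanted touch raises it to at most 1, and [sep]
    confines each request to one factor. *)
Lemma avoid_prob_le (R : realFieldType) n (E : {set 'I_n * 'I_n}) (q : R)
    m (W : 'I_m -> {set 'I_n}) alg k t h :
  (forall i, #|W i| = k.+1.*2) ->
  (forall i u v, u \in W i -> v \in W i -> (u < v)%N -> (u, v) \in E) ->
  (forall e i j, e \in E -> touches (W i) e -> touches (W j) e -> i = j) ->
  (forall i, #|[set e in E | touches (W i) e]|%:R <= q * #|E|%:R) ->
  (0 < #|E|)%N -> #|E|%:R^-1 <= q -> q <= 1 ->
  avoid_prob (fun e => (e \in E)%:R / #|E|%:R) alg k t h <=
    \prod_i (1 - hit_prob #|E|%:R^-1 q t (k.+1 ^ 3 - (energy alg (W i) h)./2)).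
Proof.
move=> sz clique sep deg E0 sq q1.
set s := #|E|%:R^-1.
have s0 : 0 <= s by rewrite invr_ge0.
have q0 : 0 <= q by apply: le_trans sq.
have E0' : #|E|%:R != 0 :> R by rewrite pnatr_eq0 -lt0n.
have g0 t' l : 0 <= hit_prob s q t' l by apply: hit_prob_ge0.
have g1 t' l : hit_prob s q t' l <= 1 by apply: hit_prob_le1.
elim: t h => [|t IH] h; rewrite [leLHS]/=; case: ifPn => np.
- by apply: prodr_ge0 => i _; rewrite subr_ge0.
(* With no step left and some hit missing, [hit_prob] is 0, so the right-hand side is 1. *)
- rewrite big1 // => i _; have := energy_lt (sz i) np.
  by rewrite -subn_gt0; case: (_ - _)%N => // l _; rewrite /= subr0.
- by apply: prodr_ge0 => i _; rewrite subr_ge0.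
pose l i := (k.+1 ^ 3 - (energy alg (W i) h)./2)%N.
have l0 i : l i = (l i).-1.+1 by rewrite prednK // subn_gt0 (energy_lt (sz i)).
have /boolp.choice [e0 he0] i := equal_disc (sz i) np.
have e0E i : e0 i \in E.
  by have [u v uv _] := he0 i; rewrite [e0 i]surjective_pairing (clique i).
pose b i := 1 - hit_prob s q t (l i).
(* The increase of the success probability of window [i] when [t] becomes [t.+1]. *)
pose y i := s * hit_prob s q t (l i).-1 - q * hit_prob s q t (l i).
have yb i : 0 <= y i <= b i.
  rewrite /y /b l0 /= subr_ge0 hit_prob_hit //=.
  by have := g1 t.+1 (l i).-1.+1; rewrite /=; lra.
rewrite [leRHS](_ : _ = \prod_i (b i - y i)); last first.
  apply: eq_bigr => i _; rewrite -/(l i) /b /y l0 /=; ring.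
apply: le_trans (prodr_sub_ge yb).
pose B i := \prod_(j | j != i) b j.
have b0 i : 0 <= b i by rewrite subr_ge0.
have B0 i : 0 <= B i by apply: prodr_ge0.
(* An edge of [E] touches at most one window, so it changes at most one factor. *)
pose z i e := (touches (W i) e)%:R * hit_prob s q t (l i)
              - (e == e0 i)%:R * hit_prob s q t (l i).-1.
have step e : e \in E -> avoid_prob (fun e => (e \in E)%:R / #|E|%:R) alg k t (e :: h)
    <= \prod_i b i + \sum_i z i e * B i.
  move=> eE; apply: le_trans (IH _) _.
  have untouched i : ~~ touches (W i) e -> (z i e = 0) *
      (1 - hit_prob s q t (k.+1 ^ 3 - (energy alg (W i) (e :: h))./2) = b i).
    move=> ti; rewrite energy_untouched //; split=> //.
    rewrite /z (negbTE ti); case: eqP => [ee|]; last by rewrite !mul0r subrr.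
    by move: ti; rewrite ee /touches; have [-> ] := he0 i.
  have [i ti|nt] := pickP (fun i => touches (W i) e); last first.
    rewrite [X in _ + X]big1 ?addr0 => [|i _]; last first.
      by rewrite untouched ?nt // mul0r.
    by under eq_bigr do rewrite untouched ?nt //.
  have nti j : j != i -> ~~ touches (W j) e.
    by apply: contra => tj; apply/eqP/(sep e).
  have -> : \sum_i z i e * B i = z i e * B i.
    by rewrite (bigD1 i) //= big1 ?addr0 // => j /nti/untouched ->; rewrite mul0r.
  have -> : \prod_i b i = b i * B i by rewrite (bigD1 i).
  rewrite (bigD1 i) //= -mulrDl (eq_bigr b) => [|j /nti/untouched ->] //.
  apply: ler_wpM2r; first exact: B0.
  rewrite /z ti mul1r /b; case: eqP => [->|_]; last first.
    rewrite mul0r.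
    have := g0 t (k.+1 ^ 3 - (energy alg (W i) (e :: h))./2)%N; lra.
  have [e1 e2 lt dd] := he0 i.
  rewrite energy_hit // ?neq_ltn ?lt //.
  have -> : (k.+1 ^ 3 - (energy alg (W i) h).+2./2)%N = (l i).-1 by rewrite /= subnS.
  by rewrite mul1r; lra.
apply: le_trans (_ : \sum_e (e \in E)%:R / #|E|%:R * (\prod_i b i + \sum_i z i e * B i) <= _).
  apply: ler_sum => e _; case: (boolP (e \in E)) => [/step|_]; last by rewrite !mul0r.
  by apply: ler_wpM2l; rewrite mul1r.
rewrite [leLHS](_ : _ = \sum_(e in E) s * (\prod_i b i + \sum_i z i e * B i)).
  2: by rewrite [RHS]big_mkcond; apply: eq_bigr => e _; case: ifP; rewrite ?mul1r ?mul0r.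
rewrite -mulr_sumr big_split sumr_const exchange_big /= mulrDr -mulr_natl mulrA.
rewrite mulVf // mul1r lerD2l mulr_sumr -sumrN ler_sum // => i _.
rewrite -mulr_suml mulrA -mulNr ler_wpM2r ?B0 //.
have -> : \sum_(e in E) z i e = #|[set e in E | touches (W i) e]|%:R
    * hit_prob s q t (l i) - hit_prob s q t (l i).-1.
  rewrite /z sumrB -!mulr_suml; congr (_ * _ - _).
    by rewrite -sum1_card natr_sum [RHS]big_mkcond [LHS]big_mkcond;
      apply: eq_bigr => e _; rewrite inE; case: (e \in E); case: touches.
  rewrite (bigD1 (e0 i)) //= eqxx big1 ?addr0 ?mul1r // => e /andP[_ /negbTE ->] //.
(* The average of [z i] over [E] is at most [- y i]: the edges touching the window have total weight
   at most [q], and the wanted edge [e0 i] has weight [s]. *)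
have sN : s * #|[set e in E | touches (W i) e]|%:R <= q.
  by rewrite mulrC ler_pdivrMr ?ltr0n.
by have := ler_wpM2r (g0 t (l i)) sN; rewrite /y; lra.
Qed.

(** * From request sequences to discrepancy vectors *)

Lemma sum_tuple_cons (R : nmodType) (V : finType) t (F : seq V -> R) :
  \sum_(r : t.+1.-tuple V) F r = \sum_e \sum_(r : t.-tuple V) F (e :: r).
Proof.
rewrite pair_big /= (reindex (fun p : V * t.-tuple V => [tuple of p.1 :: p.2])) //=.
exists (fun r => (thead r, [tuple of behead r])) => [[e r]|r] _ /=.
  by congr pair; apply: val_inj.
by rewrite -tuple_eta.
Qed.

(** [h] is the past, latest request first; [r] is the future, in order of arrival. *)
Fixpoint safe n (alg : seq ('I_n * 'I_n) -> bool) k h r : bool :=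
  ~~ peak alg k h && (if r is e :: r' then safe alg k (e :: h) r' else true).

Lemma avoid_probE (R : realFieldType) n (w : 'I_n * 'I_n -> R) alg k t h :
  avoid_prob w alg k t h =
  \sum_(r : t.-tuple ('I_n * 'I_n)) (\prod_(e <- r) w e) * (safe alg k h r)%:R.
Proof.
elim: t h => [|t IH] h /=.
  rewrite (bigD1 [tuple]) //= [X in _ + X]big1 => [|r /eqP[]]; last exact: tuple0.
  by rewrite big_nil mul1r addr0 andbT; case: ifP.
rewrite (sum_tuple_cons t (fun r => (\prod_(e <- r) w e) * (safe alg k h r)%:R)) /=.
case: ifP => _; first by rewrite big1 // => e _; rewrite big1 // => r _; rewrite mulr0.
apply: eq_bigr => e _; rewrite IH mulr_sumr; apply: eq_bigr => r _.
by rewrite big_cons mulrA.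
Qed.

Lemma sum_prod_tuple1 (R : realFieldType) n (w : 'I_n * 'I_n -> R) t :
  \sum_e w e = 1 -> \sum_(r : t.-tuple ('I_n * 'I_n)) \prod_(e <- r) w e = 1.
Proof.
move=> w1; elim: t => [|t IH].
  rewrite (bigD1 [tuple]) //= [X in _ + X]big1 => [|r /eqP[]]; last exact: tuple0.
  by rewrite big_nil addr0.
rewrite (sum_tuple_cons t (fun r => \prod_(e <- r) w e)).
under eq_bigr do under eq_bigr do rewrite big_cons.
by under eq_bigr do rewrite -mulr_sumr IH mulr1.
Qed.

Lemma discrepancyE (R : realType) n (alg : seq ('I_n * 'I_n) -> bool) r t u :
  discrepancy R alg r t 0 u = (disc alg (rev (mkseq r t)) u)%:~R.
Proof.
elim: t => [|t IH]; first by rewrite mxE.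
rewrite [in RHS]mkseqS rev_rcons /= !mxE IH rmorphD rmorphM rmorphXn rmorphB /=.
by rewrite rmorphN1 -rev_rcons revK -mkseqS.
Qed.

Lemma unsafeP n (alg : seq ('I_n * 'I_n) -> bool) k h r :
  ~~ safe alg k h r ->
  exists2 t, (t <= size r)%N & peak alg k (catrev (take t r) h).
Proof.
elim: r h => [|e r IH] h /=; first by rewrite andbT negbK => pk; exists 0%N.
rewrite negb_and negbK => /orP[pk|/IH[t tr pk]]; first by exists 0%N.
by exists t.+1.
Qed.

Lemma max_discrepancy_ge (R : realType) n (alg : seq ('I_n * 'I_n) -> bool) r T t u :
  (t <= T)%N -> `|discrepancy R alg r t 0 u| <= max_discrepancy R alg r T.
Proof.
move=> tT; rewrite /max_discrepancy (bigD1 (Ordinal (tT : (t < T.+1)%N))) //=.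
rewrite le_max; apply/orP; left.
rewrite -[leRHS]/(mx_norm _) mx_normrE (bigD1 (0, u)) //= le_max lexx //.
Qed.

Lemma unsafe_max_discrepancy (R : realType) n (alg : seq ('I_n * 'I_n) -> bool) k r T :
  ~~ safe alg k [::] (mkseq r T) -> k.+1%:R <= max_discrepancy R alg r T.
Proof.
move=> /unsafeP[t]; rewrite size_mkseq => tT /existsP[u].
rewrite catrevE cats0 -map_take take_iota (minn_idPl tT) -/(mkseq r t) => pk.
apply: le_trans (max_discrepancy_ge R alg r u tT).
by rewrite discrepancyE -intr_norm -[k.+1%:R]/(k.+1%:Z%:~R) ler_int; lia.
Qed.

Lemma discrepancy_ext (R : realType) n (alg alg' : seq ('I_n * 'I_n) -> bool) r r' t :
  (forall i, (i < t)%N -> r i = r' i) ->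
  (forall i, (i < t)%N -> alg (mkseq r i.+1) = alg' (mkseq r i.+1)) ->
  discrepancy R alg r t = discrepancy R alg' r' t.
Proof.
elim: t => [//|t IH] rr aa /=.
have -> : discrepancy R alg r t = discrepancy R alg' r' t.
  by apply: IH => i it; [apply: rr|apply: aa]; apply: ltnW.
have -> : mkseq r' t.+1 = mkseq r t.+1.
  by apply/eq_in_map => i; rewrite mem_iota => /rr.
by rewrite aa ?rr.
Qed.

(** Only finitely many requests and decisions matter. This allows replacing request streams by
    tuples, and yields measurability in the seed. *)
Lemma max_discrepancy_ext (R : realType) n (alg alg' : seq ('I_n * 'I_n) -> bool) r r' T :
  (forall i, (i < T)%N -> r i = r' i) ->
  (forall i, (i < T)%N -> alg (mkseq r i.+1) = alg' (mkseq r i.+1)) ->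
  max_discrepancy R alg r T = max_discrepancy R alg' r' T.
Proof.
move=> rr aa; apply: eq_bigr => t _; congr `|_|.
by apply: discrepancy_ext => i /leq_trans/(_ (ltn_ord t : (t <= T)%N)) iT; [apply: rr|apply: aa].
Qed.

(** * Edge counts and circulant graphs *)

Lemma card_interval n a b :
  #|[set v : 'I_n | (a <= v < b)%N]| = (minn n b - a)%N.
Proof.
transitivity (\sum_(v < n) (a <= v < b))%N.
  by rewrite -sum1_card big_mkcond; apply: eq_bigr => v _; rewrite inE; case: (_ <= _ < _)%N.
elim: n => [|n IH]; first by rewrite big_ord0; lia.
rewrite big_ord_recr /= {}IH; lia.
Qed.

Lemma sum_regular n (g : rel 'I_n) Delta (W : {set 'I_n}) :
  regular_graph g Delta ->
  (\sum_(p : 'I_n * 'I_n) ((p.1 \in W) && g p.1 p.2) = #|W| * Delta)%N.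
Proof.
move=> reg; transitivity (\sum_u \sum_v ((u \in W) && g u v))%N.
  by rewrite pair_bigA.
rewrite -sum_nat_const [RHS]big_mkcond; apply: eq_bigr => u _.
case: (u \in W); last by rewrite big1.
rewrite -(reg u) -sum1_card [RHS]big_mkcond; apply: eq_bigr => v _.
by rewrite inE; case: (g u v).
Qed.

Lemma sum_swap n (F : 'I_n * 'I_n -> nat) :
  (\sum_p F (p.2, p.1) = \sum_p F p)%N.
Proof.
rewrite [RHS](reindex (fun p : 'I_n * 'I_n => (p.2, p.1))) //=.
by exists (fun p => (p.2, p.1)) => [[]|[]].
Qed.

Lemma card_edge_set n (g : rel 'I_n) Delta :
  simple_graph g -> regular_graph g Delta -> (#|edge_set g|.*2 = n * Delta)%N.
Proof.
move=> [sym irr] /(sum_regular [set: 'I_n]); rewrite cardsT card_ord => <-.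
have -> : #|edge_set g| = (\sum_(p : 'I_n * 'I_n) ((p.1 < p.2) && g p.1 p.2))%N.
  by rewrite -sum1_card big_mkcond; apply: eq_bigr => v _; rewrite inE; case: (_ && _).
rewrite -addnn -{2}sum_swap -big_split /=; apply: eq_bigr => -[u v] _ /=.
rewrite inE [g v u]sym; case: ltngtP => [_|_|/val_inj ->]; rewrite ?addn0 ?add0n //=.
by rewrite irr.
Qed.

Lemma card_touching n (g : rel 'I_n) Delta (W : {set 'I_n}) :
  simple_graph g -> regular_graph g Delta ->
  (#|[set e in edge_set g | touches W e]| <= (#|W| * Delta).*2)%N.
Proof.
move=> [sym _] /(sum_regular W) <-.
rewrite -addnn -{2}sum_swap -big_split /= -sum1_card big_mkcond leq_sum // => -[u v] _.
by rewrite !inE /touches /= [g v u]sym; case: (u \in W); case: (v \in W); case: (g u v); case: ltnP.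
Qed.

(** Subtraction in ['I_n.+1] is modulo [n.+1], so neighbours are the vertices at cyclic distance at
    most [Delta./2], plus, for odd [Delta], the antipode, which exists when [n.+1] is even. *)
Definition circulant n (Delta : nat) : rel 'I_n.+1 := fun u v =>
  let d : nat := v - u in
  (0 < d)%N && [|| (d <= Delta./2)%N, (n.+1 - Delta./2 <= d)%N
                 | odd Delta && (d.*2 == n.+1)].

Lemma circulant_simple n Delta : simple_graph (circulant Delta : rel 'I_n.+1).
Proof.
split=> [u v|u]; rewrite /circulant; last by rewrite subrr.
set d := nat_of_ord (v - u); have dn : (d < n.+1)%N := ltn_ord (v - u).
have -> : nat_of_ord (u - v) = ((n.+1 - d) %% n.+1)%N by rewrite -opprB.
have [->|d0] := posnP d; first by rewrite subn0 modnn.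
by rewrite modn_small; lia.
Qed.

Lemma circulant_regular n Delta : (Delta < n.+1)%N -> ~~ odd (n.+1 * Delta) ->
  regular_graph (circulant Delta : rel 'I_n.+1) Delta.
Proof.
move=> Dn ev u.
pose S (d : nat) := (0 < d)%N && [|| (d <= Delta./2)%N, (n.+1 - Delta./2 <= d)%N
                 | odd Delta && (d.*2 == n.+1)].
transitivity #|(fun v => v - u) @^-1: [set d : 'I_n.+1 | S d]|.
  by apply: eq_card => v; rewrite !inE.
rewrite card_preimset; last exact: addIr.
pose I a b := [set v : 'I_n.+1 | (a <= v < b)%N].
have cI a b : (\sum_(d : 'I_n.+1) (a <= d < b))%N = (minn n.+1 b - a)%N.
  rewrite -card_interval -sum1_card [RHS]big_mkcond.
  by apply: eq_bigr => v _; rewrite inE; case: (_ <= _ < _)%N.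
(* Two disjoint arcs of [Delta./2] differences and, for odd [Delta], the single antipodal
   difference. *)
transitivity (\sum_(d : 'I_n.+1) ((1 <= d < Delta./2.+1) + (n.+1 - Delta./2 <= d < n.+1)
   + (n.+1./2 <= d < n.+1./2 + odd Delta)))%N.
  rewrite -sum1_card big_mkcond; apply: eq_bigr => d _; rewrite inE /S.
  move: ev Dn (ltn_ord d) (odd_double_half Delta) (odd_double_half n.+1).
  rewrite oddM; set x := nat_of_ord d.
  case: (odd Delta); case: (odd n.+1) => //= _; case: ifP => /=; lia.
rewrite !big_split /= !cI; lia.
Qed.

(** In the lower half of the cycle, differences do not wrap around and stay below the antipodal
    one. *)
Lemma circulant_near n Delta (u v : 'I_n.+1) :
  (Delta <= n)%N -> (u < v)%N -> (v.*2 <= n)%N ->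
  circulant Delta u v = (v - u <= Delta./2)%N.
Proof.
move=> Dn uv vn; rewrite /circulant /=.
rewrite modnDmr addnBA ?(ltnW (ltn_ord u)) // addnC -addnBA ?(ltnW uv) // modnDl modn_small; lia.
Qed.

(** * Numerical estimates *)

Lemma bernoulli_le (R : realFieldType) (x : R) t :
  -1 <= x -> 1 + t%:R * x <= (1 + x) ^+ t.
Proof.
move=> x1; elim: t => [|t IH]; first by rewrite mul0r addr0.
rewrite exprS; apply: le_trans (ler_wpM2l _ IH); last by lra.
rewrite -natr1 -subr_ge0 (_ : _ - _ = t%:R * x ^+ 2); last by ring.
by rewrite mulr_ge0 ?sqr_ge0.
Qed.

(** Bernoulli's inequality for [(1 + x) ^+ t], combined with (1 - x^2)^t <= 1. *)
Lemma expr_1B_le (R : realFieldType) (x : R) t :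
  0 < x -> x <= 1 -> (0 < t)%N -> (1 - x) ^+ t <= (t%:R * x)^-1.
Proof.
move=> x0 x1 t0; have tx0 : 0 < t%:R * x by rewrite mulr_gt0 ?ltr0n.
rewrite -[leRHS]mul1r ler_pdivlMr //.
apply: le_trans (_ : (1 - x) ^+ t * (1 + x) ^+ t <= _).
  rewrite ler_wpM2l ?exprn_ge0 ?subr_ge0 //.
  by apply: le_trans (@bernoulli_le _ x t _); lra.
by rewrite -exprMn exprn_ile1 //; nra.
Qed.

Lemma bin_ge t l : ((t - l) ^ l <= 'C(t, l) * l ^ l)%N.
Proof.
have ffact_ge a b : ((a - b) ^ b <= a ^_ b)%N.
  elim: b a => [|b IH] a //; rewrite ffactnS expnS.
  have -> : (a - b.+1 = a.-1 - b)%N by lia.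
  by rewrite leq_mul //; lia.
have ffact_le a b : (a ^_ b <= a ^ b)%N.
  elim: b a => [|b IH] a //; rewrite ffactnS expnS leq_mul // (leq_trans (IH _)) //.
  by case: b {IH} => // b; rewrite leq_exp2r // leq_pred.
apply: leq_trans (ffact_ge t l) _.
by rewrite -bin_ffact leq_mul // -ffactnn.
Qed.

Lemma hit_prob_large (R : realFieldType) (N Delta k M : nat) :
  (16 * k.+1 ^ 3 <= Delta)%N -> (Delta ^ 2 <= N)%N -> (M.*2 = N * Delta)%N ->
  ((Delta ^ (3 * k.+1 ^ 3)).*2%:R)^-1 <=
    hit_prob M%:R^-1 ((8 * k.+1)%:R / N%:R) N (k.+1 ^ 3) :> R.
Proof.
set L := (k.+1 ^ 3)%N => LD DN MN.
have kL : (k < L)%N by rewrite /L !expnS expn0; nia.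
have D0 : (0 < Delta)%N by lia.
have DN' : (Delta * Delta <= N)%N by rewrite -[X in (X <= _)%N]/(Delta ^ 2)%N.
have N0 : (0 < N)%N by nia.
have M0 : (0 < M)%N by nia.
have NR : 0 < N%:R :> R by rewrite ltr0n.
have MR : 0 < M%:R :> R by rewrite ltr0n.
set q := _ / N%:R; set s := M%:R^-1.
have s0 : 0 <= s by rewrite invr_ge0 ltW.
have q0 : 0 <= q by rewrite divr_ge0.
have q1 : q <= 1 by rewrite ler_pdivrMr // mul1r ler_nat; nia.
(* Only about N / Delta steps are used: then [T * q] is at most 1/2, and [(1 - q) ^+ T] is at least
   1/2. *)
pose T := (N %/ Delta)%N.
have TN : (T <= N)%N by apply: leq_div.
apply: le_trans (hit_prob_mono L s0 q0 q1 TN).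
apply: le_trans (hit_prob_ge T L s0 q0 q1).
have TD : (T * Delta <= N < T * Delta + Delta)%N.
  by have := divn_eq N Delta; have := ltn_pmod N D0; rewrite -/T; lia.
have half : 2^-1 <= (1 - q) ^+ T.
  apply: le_trans (@bernoulli_le _ (- q) T _); last by lra.
  suff : T%:R * q <= 2^-1 by lra.
  rewrite mulrA ler_pdivrMr // -natrM -[leRHS]mulrC ler_pdivlMr // -natrM ler_nat.
  nia.
have main : ((Delta ^ (3 * L))%:R)^-1 <= 'C(T, L)%:R * s ^+ L.
  have L0 : (0 < L ^ L)%N by rewrite expn_gt0; lia.
  have := bin_ge T L; rewrite -(ler_nat R) natrM => h.
  have s0' : 0 < s ^+ L by rewrite exprn_gt0 // invr_gt0.
  rewrite -(ler_pM2r (_ : 0 < (L ^ L)%:R)) ?ltr0n // mulrAC.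
  apply: le_trans (ler_wpM2r (ltW s0') h).
  rewrite /s exprVn -natrX ler_pdivlMr ?ltr0n ?expn_gt0 ?M0 // mulrC [_^-1 * _]mulrC mulrA.
  rewrite ler_pdivrMr ?ltr0n ?expn_gt0 ?D0 // -!natrM ler_nat.
  rewrite expnM -!expnMn leq_exp2r; last by lia.
  rewrite !expnS expn0 muln1.
  (* [L] is small against [T]. With M = N Delta / 2, each of the [L] factors (T - L) / (L M) is at
     least 1 / (L Delta^2), hence at least Delta^(-3). *)
  have TL : (N <= ((T - L) * Delta).*2)%N by nia.
  nia.
rewrite -mul2n natrM invfM mulrC.
by apply: ler_pM => //; rewrite invr_ge0.
Qed.

(** * Avoidance probability on the circulant *)

Lemma avoid_prob_circulant (R : realFieldType) n Delta k alg :
  (Delta <= n)%N -> ~~ odd (n.+1 * Delta) ->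
  (16 * k.+1 ^ 3 <= Delta)%N -> (Delta ^ 2 <= n.+1)%N ->
  avoid_prob (fun e => (e \in edge_set (@circulant n Delta))%:R
                         / #|edge_set (@circulant n Delta)|%:R) alg k n.+1 [::] <=
    (8 * Delta ^ (3 * k.+1 ^ 3).+1)%:R / n.+1%:R :> R.
Proof.
set E := edge_set _; move=> Dn ev LD DN; set L := (k.+1 ^ 3)%N in LD *; set N := n.+1.
have simple : simple_graph (circulant Delta : rel 'I_n.+1) by exact: circulant_simple.
have reg := circulant_regular Dn ev.
have kL : (k < L)%N by rewrite /L !expnS expn0; nia.
have DN' : (Delta * Delta <= N)%N by rewrite -[X in (X <= _)%N]/(Delta ^ 2)%N.
have EN : (#|E|.*2 = N * Delta)%N by exact: card_edge_set.
have E0 : (0 < #|E|)%N by rewrite /N in EN *; nia.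
have NR : 0 < N%:R :> R by rewrite ltr0n.
have ER : 0 < #|E|%:R :> R by rewrite ltr0n.
(* The windows start [Delta] apart in the lower half, where [circulant_near] applies. Their length
   2(k + 1) is at most Delta / 8, which makes them cliques and leaves gaps longer than
   [Delta./2]. *)
pose m := (N./2 %/ Delta)%N.
have mD : (m * Delta <= N./2 < m * Delta + Delta)%N.
  have D0 : (0 < Delta)%N by lia.
  by have := divn_eq N./2 Delta; have := ltn_pmod N./2 D0; rewrite -/m; lia.
pose W (i : 'I_m) := [set v : 'I_n.+1 | (i * Delta <= v < i * Delta + k.+1.*2)%N].
have Wlow i v : v \in W i -> (v.*2.+2 <= N)%N.
  by rewrite inE; have := ltn_ord i; nia.
have sz i : #|W i| = k.+1.*2.
  have : (i.+1 * Delta <= m * Delta)%N by rewrite leq_mul2r ltn_ord orbT.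
  by rewrite card_interval; lia.
have clique i u v : u \in W i -> v \in W i -> (u < v)%N -> (u, v) \in E.
  move=> uW vW uv; rewrite inE uv circulant_near //=; last by have := Wlow _ _ vW; lia.
  by move: uW vW; rewrite !inE; lia.
have far i j u v : u \in W i -> v \in W j -> (i < j)%N -> (v - u > Delta./2)%N.
  rewrite !inE => ui vj ij; have : (i.+1 * Delta <= j * Delta)%N by rewrite leq_mul2r ij orbT.
  by lia.
have sep_lt e i j : e \in E -> touches (W i) e -> touches (W j) e -> (i < j)%N -> False.
  case: e => a b; rewrite inE /= => /andP[ab adj].
  case/orP=> /= [ai|bi] /orP[/= aj|/= bj] ij.
  - by have := far _ _ _ _ ai aj ij; rewrite subnn.
  - have := far _ _ _ _ ai bj ij; move: adj.
    by rewrite circulant_near //; [lia | have := Wlow _ _ bj; lia].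
  - by have := far _ _ _ _ bi aj ij; lia.
  - by have := far _ _ _ _ bi bj ij; rewrite subnn.
have sep e i j : e \in E -> touches (W i) e -> touches (W j) e -> i = j.
  move=> eE ti tj; apply: val_inj; case: (ltngtP i j) => // ij; exfalso.
    exact: (sep_lt e i j).
  exact: (sep_lt e j i).
(* A window is touched by at most 4(k + 1) Delta of the N Delta / 2 edges, whence the 8. *)
pose q : R := (8 * k.+1)%:R / N%:R.
have deg i : #|[set e in E | touches (W i) e]|%:R <= q * #|E|%:R.
  rewrite /q mulrAC ler_pdivlMr // -!natrM ler_nat.
  by have := card_touching (W i) simple reg; rewrite sz -/E; nia.
have sq : #|E|%:R^-1 <= q.
  rewrite -[leLHS]mul1r /q ler_pdivrMr // mulrAC ler_pdivlMr // mul1r -natrM ler_nat; nia.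
have q1 : q <= 1 by rewrite ler_pdivrMr // mul1r ler_nat; nia.
apply: le_trans (avoid_prob_le alg N [::] sz clique sep deg E0 sq q1) _.
have e0 i : energy alg (W i) [::] = 0%N by rewrite /energy big1.
rewrite (eq_bigr (fun=> 1 - hit_prob #|E|%:R^-1 q N L)) => [|i _]; last first.
  by rewrite e0 subn0.
rewrite prodr_const card_ord.
have large := @hit_prob_large R N Delta k #|E| LD DN EN.
rewrite -/L -/q in large.
have p0 : 0 < ((Delta ^ (3 * L)).*2%:R)^-1 :> R.
  by rewrite invr_gt0 ltr0n double_gt0 expn_gt0; lia.
have m0 : (0 < m)%N by nia.
have s0 : 0 <= #|E|%:R^-1 :> R by rewrite invr_ge0 ltW.
(* (1 - p)^m is at most 1 / (m p), with p at least 1 / (2 Delta^(3L)) and m at least N / (4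
   Delta). *)
apply: le_trans (expr_1B_le (lt_le_trans p0 large) _ m0) _; first exact: hit_prob_le1.
apply: le_trans (_ : (m%:R * ((Delta ^ (3 * L)).*2%:R)^-1)^-1 <= _).
  have mR : 0 < m%:R :> R by rewrite ltr0n.
  by rewrite lef_pV2 ?posrE ?mulr_gt0 // ?(lt_le_trans p0) // ler_wpM2l // ltW.
rewrite invfM invrK mulrC ler_pdivrMr ?ltr0n // mulrAC ler_pdivlMr // -!natrM ler_nat.
rewrite expnS; set Z := (_ ^ _)%N.
have : (N <= 4 * (Delta * m))%N by nia.
by move=> h; have := leq_mul (leqnn Z.*2) h; lia.
Qed.

(** * Measurability and randomized algorithms *)

Local Open Scope classical_set_scope.

(** Splitting on the value of [alg s h] fixes one input of [F] at a time, until none is left. *)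
Lemma measurable_finitely_determined d (S : measurableType d) (T : eqType)
    (alg : S -> T -> bool) (hs : seq T) (F : (T -> bool) -> Prop) :
  (forall h, measurable_fun setT (fun s => alg s h)) ->
  (forall b b', {in hs, b =1 b'} -> F b -> F b') ->
  measurable [set s | F (alg s)].
Proof.
move=> malg; elim: hs F => [|h hs IH] F FE.
  have [F0|nF0] := pselect (F (fun=> true)).
    by rewrite (_ : [set s | _] = setT) //; apply/seteqP; split=> s //= _; apply: FE F0.
  by rewrite (_ : [set s | _] = set0) //; apply/seteqP; split=> s //= Fs;
    apply/nF0/(FE _ _ _ Fs).
pose upd b (a : T -> bool) h' := if h' == h then b else a h'.
have mF b : measurable ([set s | alg s h = b] `&` [set s | F (upd b (alg s))]).
  apply: measurableI.
    by have := malg h measurableT [set b] I; rewrite setTI.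
  apply: (IH (fun a => F (upd b a))) => a a' aa; apply: FE => h'.
  by rewrite inE /upd; case: eqP => //= _ /aa.
rewrite (_ : [set s | _] = ([set s | alg s h = true] `&` [set s | F (upd true (alg s))])
   `|` ([set s | alg s h = false] `&` [set s | F (upd false (alg s))])); first exact: measurableU.
have updE s b : alg s h = b -> upd b (alg s) = alg s.
  by move=> sb; apply/funext => h'; rewrite /upd; case: eqP => // ->.
apply/seteqP; split=> s /=.
  by move=> Fs; case sb: (alg s h); [left|right]; rewrite updE.
by case=> -[sb]; rewrite updE.
Qed.

Lemma integral_sum_indic d (T : measurableType d) (R : realType)
    (mu : {measure set T -> \bar R}) (I : finType) (c : I -> R) (D : I -> set T) :
  (forall i, 0 <= c i) -> (forall i, measurable (D i)) ->
  (\int[mu]_w (\sum_i c i * \1_(D i) w)%:E = \sum_i (c i)%:E * mu (D i))%E.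
Proof.
move=> c0 mD.
under eq_integral do rewrite -sumEFin.
rewrite ge0_integral_sum //=.
- apply: eq_bigr => i _; rewrite (integralZl_indic _ (fun=> D i)) //.
    by rewrite integral_indic // setIT.
  by move=> c1; have := c0 i; rewrite leNgt c1.
- move=> i; apply/measurable_EFinP; apply: measurable_funM => //.
- by move=> i w _; rewrite lee_fin mulr_ge0.
Qed.

Lemma prob_requests (R : realType) (d d' : measure_display)
    (Omega : measurableType d) (S : measurableType d') (P : probability Omega R)
    (V : finType) (E : {set V}) n (X : nat -> Omega -> V) (U : Omega -> S)
    (r : n.-tuple V) (A : set S) :
  iid_uniform_requests P E n X U -> measurable A ->
  P ([set w | [tuple X t w | t < n] = r] `&` U @^-1` A) =
    ((\prod_(e <- r) ((e \in E)%:R / #|E|%:R))%:E * P (U @^-1` A))%E.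
Proof.
case=> mX uX indep mA.
pose B o := if o is Some t then X (t : 'I_n) @^-1` [set tnth r t] else U @^-1` A.
have := indep [set: option 'I_n]%SET B.
rewrite (_ : \bigcap_(o in _) B o = [set w | [tuple X t w | t < n] = r] `&` U @^-1` A).
  move=> -> => [|[t|] _].
  - transitivity (\prod_o P (B o))%E; first by apply: eq_bigl => o; rewrite inE.
    rewrite (bigD1 None) //= muleC; congr (_ * _)%E.
    rewrite (reindex_omap Some id) /=; last by case.
    transitivity (\prod_t P (B (Some t)))%E; first by apply: eq_bigl => t; rewrite eqxx.
    rewrite big_tuple -prodEFin; apply: eq_bigr => t _; exact: uX.
  - by exists [set tnth r t] => //; rewrite setTI.
  - by exists A => //; rewrite setTI.
apply/seteqP; split=> w /=.
  move=> h; split; last by have := h None; apply; rewrite /= inE.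
  apply: eq_from_tnth => t; rewrite tnth_mktuple.
  by have := h (Some t); apply; rewrite /= inE.
by case=> rE Uw [t|] _ //=; rewrite -rE tnth_mktuple.
Qed.

(** Conditioning on the seed: the event is cut along the finitely many request tuples, independence
    factors each piece, and the weighted sum is reassembled under the integral, where it is at least
    [a] for every seed. *)
Lemma prob_online_ge (R : realType) (d d' : measure_display)
    (Omega : measurableType d) (S : measurableType d') (P : probability Omega R)
    (V : finType) (E : {set V}) n (X : nat -> Omega -> V) (U : Omega -> S)
    (A : n.-tuple V -> set S) (a : R) :
  measurable_fun setT U -> iid_uniform_requests P E n X U ->
  (forall r, measurable (A r)) -> 0 <= a ->
  (forall s, a <= \sum_(r : n.-tuple V)
      (\prod_(e <- r) ((e \in E)%:R / #|E|%:R)) * \1_(A r) s) ->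
  (a%:E <= P [set w | A [tuple X t w | t < n] (U w)])%E.
Proof.
move=> mU iid mA a0 aA.
have mUA r : measurable (U @^-1` A r) by rewrite -[_ @^-1` _]setTI; exact: mU.
pose C r := [set w | [tuple X t w | t < n] = r] `&` U @^-1` A r.
have mC r : measurable (C r).
  apply: measurableI => //.
  rewrite (_ : [set w | _] = \bigcap_(t in [set: 'I_n]) X t @^-1` [set tnth r t]).
    apply: fin_bigcap_measurable => // t _; case: iid => mX _ _; exact: mX.
  apply/seteqP; split=> w /= => [<- t _|h]; first by rewrite /= tnth_mktuple.
  by apply: eq_from_tnth => t; rewrite tnth_mktuple h.
have c0 (r : n.-tuple V) : 0 <= \prod_(e <- r) ((e \in E)%:R / #|E|%:R) :> R.
  by rewrite prodr_ge0.
set Ev := [set w | _].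
have EvE w : \1_Ev w = \sum_(r : n.-tuple V) 1 * \1_(C r) w :> R.
  rewrite (bigD1 [tuple X t w | t < n]) //= big1 ?addr0 ?mul1r.
    by rewrite !indicE; congr ((nat_of_bool _)%:R); apply/idP/idP; rewrite !inE /C /Ev //=; case.
  by move=> r /eqP rX; rewrite mul1r indicE memNset // /C /= => -[/esym].
have mEv : measurable Ev.
  rewrite (_ : Ev = \bigcup_(r in [set: n.-tuple V]) C r).
    by apply: fin_bigcup_measurable.
  apply/seteqP; split=> w /= => [h|[r _ [<- h]] //].
  by exists [tuple X t w | t < n].
have -> : P Ev = (\int[P]_w (\1_Ev w)%:E)%E by rewrite integral_indic // setIT.
under eq_integral do rewrite EvE.
rewrite integral_sum_indic //.
rewrite (_ : \sum_r _ = \sum_(r : n.-tuple V)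
    (\prod_(e <- r) ((e \in E)%:R / #|E|%:R))%:E * P (U @^-1` A r))%E; last first.
  by apply: eq_bigr => r _; rewrite mul1e; exact: prob_requests.
rewrite -integral_sum_indic //.
rewrite -[leLHS](_ : \int[P]_w (cst a%:E) w = _)%E; last first.
  by rewrite integral_cst //= [X in (_ * X)%E](_ : _ = 1%E) ?mule1 //; exact: probability_setT.
apply: ge0_le_integral => //=.
- apply/measurable_EFinP; apply: measurable_sum => r; apply: measurable_funM => //.
- by move=> w _; rewrite lee_fin; apply: aA.
Qed.

Lemma prob_max_discrepancy_ge (R : realType) n (E : {set 'I_n.+1 * 'I_n.+1}) k (y eta : R)
    (d d' : measure_display) (Omega : measurableType d)
    (S : measurableType d') (P : probability Omega R) T
    (X : nat -> Omega -> 'I_n.+1 * 'I_n.+1) (U : Omega -> S)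
    (alg : S -> seq ('I_n.+1 * 'I_n.+1) -> bool) :
  (0 < #|E|)%N -> y <= k.+1%:R -> eta <= 1 ->
  (forall b, avoid_prob (fun e => (e \in E)%:R / #|E|%:R) b k T [::] <= eta) ->
  measurable_fun setT U -> iid_uniform_requests P E T X U -> online_algorithm alg ->
  ((1 - eta)%:E <= P [set w : Omega |
     (y <= max_discrepancy R (alg (U w)) (fun t => X t w) T)%R])%E.
Proof.
move=> E0 yk eta1 avoid mU iid malg.
(* A default for [nth], never read: only indices below [T] matter. *)
pose e0 : 'I_n.+1 * 'I_n.+1 := (ord0, ord0).
pose A (r : T.-tuple _) := [set s | y <= max_discrepancy R (alg s) (nth e0 r) T].
rewrite (_ : [set w | _] = [set w | A [tuple X t w | t < T] (U w)]); last first.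
  apply/seteqP; split=> w; rewrite /A /=;
    rewrite -(@max_discrepancy_ext R _ (alg (U w)) _ (X^~ w)) // => i iT;
    by rewrite -[i]/(nat_of_ord (Ordinal iT)) nth_mktuple.
apply: (prob_online_ge mU iid) => [r||s]; last 2 first.
- by rewrite subr_ge0.
- have w1 : \sum_e (e \in E)%:R / #|E|%:R = 1 :> R.
    rewrite -mulr_suml -(natr_sum _ _ _ (fun e => nat_of_bool (e \in E))).
    rewrite (_ : (\sum_e _)%N = #|E|) ?divff ?pnatr_eq0 -?lt0n //.
    by rewrite -sum1_card [RHS]big_mkcond; apply: eq_bigr => e _; case: (e \in E).
  (* 1 is the total weight of all sequences; the safe ones weigh at most [eta], and every unsafe one
     lies in the event. *)
  rewrite lerBlDl -[leLHS](sum_prod_tuple1 T w1).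
  apply: le_trans (lerD (avoid (alg s)) (lexx _)); rewrite avoid_probE -big_split /=.
  apply: ler_sum => r _ /=; rewrite -mulrDr ler_peMr //.
    by apply: prodr_ge0 => e _; rewrite divr_ge0.
  case: (boolP (safe _ _ _ _)) => [_|unsafe]; first by rewrite lerDl.
  rewrite add0r indicE mem_set // /A /= (le_trans yk) // unsafe_max_discrepancy //.
  by rewrite -{2}(size_tuple r) mkseq_nth.
apply: (@measurable_finitely_determined _ _ _ alg
  [seq mkseq (nth e0 r) i.+1 | i <- iota 0 T]
  (fun b => y <= max_discrepancy R b (nth e0 r) T)) => // b b' bb.
rewrite (@max_discrepancy_ext R _ b b' (nth e0 r) (nth e0 r)) // => i iT.
by apply: bb; apply: map_f; rewrite mem_iota.
Qed.

(** * Choice of parameters *)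

Lemma avoid_prob_le_sqrt (R : realType) (c y : R) n Delta :
  0 < c -> expR 1 <= Delta%:R :> R -> c * ln n.+1%:R <= Delta%:R ->
  (Delta <= n)%N -> ~~ odd (n.+1 * Delta) ->
  y <= Num.min (4^-1) (c / 128) * (ln (n.+1%:R : R) / ln (Delta%:R : R)) `^ 3^-1 ->
  exists2 k, y <= k.+1%:R & forall alg,
    avoid_prob (fun e => (e \in edge_set (@circulant n Delta))%:R
                         / #|edge_set (@circulant n Delta)|%:R) alg k n.+1 [::]
    <= 8 / Num.sqrt n.+1%:R :> R.
Proof.
have expL a : (0 < a -> (3 * a).+1 * 2 <= 8 * a)%N by lia.
move=> c0 De cD Dn ev; set x := ln _ / ln _; set c' := Num.min _ _ => yx.
(* If [y <= 1], the first requested edge already gives discrepancy 1 at its endpoints. Otherwise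
   rounding costs only a factor 2: k + 1 <= 2 y. *)
have [y1|y1] := leP y 1.
  exists 0%N => // alg; rewrite [leLHS]/=; case: ifP => _; first by rewrite divr_ge0.
  rewrite big1 ?divr_ge0 // => e _.
  have [eE|_] := boolP (e \in _); last by rewrite !mul0r.
  suff pk : peak alg 0 [:: e] by rewrite avoid_prob_peak ?mulr0.
  apply/existsP; exists e.1 => /=; rewrite add0r eqxx.
  move: eE; rewrite inE => /andP[lt _].
  have /negbTE -> : e.1 != e.2 by rewrite neq_ltn lt.
  by case: (alg _).
have D0 : 0 < Delta%:R :> R by apply: lt_le_trans De; apply: expR_gt0.
have lnD : 1 <= ln (Delta%:R : R) by rewrite -[leLHS]expRK ler_ln ?posrE ?expR_gt0.
have lnD0 : 0 < ln (Delta%:R : R) by apply: lt_le_trans lnD.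
have lnN : 0 <= ln (n.+1%:R : R) by rewrite ln_ge0 // ler1n.
have x0 : 0 <= x by rewrite divr_ge0 // ltW.
have c'0 : 0 < c' by rewrite lt_min invr_gt0 ltr0n divr_gt0.
(* This bound gives 64 c'^3 <= 1, hence Delta^(8L) <= N; the next one gives 16 L <= Delta through c
   ln N <= Delta. *)
have c'4 : c' <= 4^-1 by rewrite ge_min lexx.
have c'c : c' <= c / 128 by rewrite ge_min lexx orbT.
pose k := Num.truncn y; exists k; first exact/ltW/truncnS_gt.
set L := (k.+1 ^ 3)%N.
have k2y : k.+1%:R <= 2 * y.
  have : (Num.truncn y)%:R <= y by rewrite truncn_le; lra.
  by rewrite -/k -natr1; lra.
have Lx : L%:R <= 8 * c' ^+ 3 * x.
  have y3 : y ^+ 3 <= c' ^+ 3 * x.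
    rewrite -[in leRHS](_ : (x `^ 3^-1) ^+ 3 = x); last first.
      by rewrite -powR_mulrn ?powR_ge0 // -powRrM mulVf // powRr1.
    by rewrite -exprMn lerXn2r ?nnegrE ?mulr_ge0 ?powR_ge0 ?(ltW c'0) //; lra.
  rewrite /L natrX; apply: le_trans (_ : (2 * y) ^+ 3 <= _).
    by rewrite lerXn2r ?nnegrE ?ler0n //; lra.
  have := ler_wpM2l (ler0n R 8) y3; rewrite exprMn -natrX; lra.
have LlnD : L%:R * ln (Delta%:R : R) <= 8 * c' ^+ 3 * ln n.+1%:R.
  by rewrite -ler_pdivlMr // -[leRHS]mulrA.
have c3 : c' ^+ 3 <= c' / 16.
  by rewrite exprS ler_wpM2l ?(ltW c'0) //; nra.
have c'lnN : c' ^+ 3 * ln n.+1%:R <= 64^-1 * ln n.+1%:R.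
  by rewrite ler_wpM2r //; lra.
have c'D : c' ^+ 3 * ln n.+1%:R <= Delta%:R / 128.
  apply: le_trans (_ : c / 128 * ln n.+1%:R <= _); last by lra.
  by rewrite ler_wpM2r //; lra.
have LD : (16 * L <= Delta)%N.
  rewrite -(ler_nat R) natrM.
  have : L%:R * 1 <= L%:R * ln (Delta%:R : R) by rewrite ler_wpM2l.
  by lra.
have DL : (Delta ^ (8 * L) <= n.+1)%N.
  rewrite -(ler_nat R) -ler_ln ?posrE ?ltr0n ?expn_gt0 -?(ltr0n R) ?D0 //.
  rewrite natrX lnXn // -[leLHS]mulr_natl natrM; lra.
move=> alg.
have L0 : (0 < L)%N by rewrite expn_gt0.
have D0' : (0 < Delta)%N by rewrite -(ltr0n R).
have D2 : (Delta ^ 2 <= n.+1)%N.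
  by apply: leq_trans DL; apply: (leq_pexp2l D0'); rewrite (leq_trans _ (leq_mul (leqnn 8) L0)).
apply: le_trans (avoid_prob_circulant R alg Dn ev LD D2) _.
have N0 : 0 < n.+1%:R :> R by rewrite ltr0n.
have sN0 : 0 < Num.sqrt n.+1%:R :> R by rewrite sqrtr_gt0.
rewrite ler_pdivrMr // mulrAC ler_pdivlMr // -[n.+1%:R in leRHS]sqr_sqrtr ?ler0n // expr2.
rewrite mulrA ler_pM2r // natrM ler_pM2l ?ltr0n //.
(* After squaring, the exponent 2(3L + 1) is at most 8L because L >= 1. *)
rewrite -(@ler_pXn2r _ 2) ?nnegrE ?ler0n ?(ltW sN0) // sqr_sqrtr ?ler0n // -natrX ler_nat.
by apply: leq_trans DL; rewrite -expnM; exact: leq_pexp2l D0' (expL L L0).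
Qed.

Theorem theorem1p3 (R : realType) (c : R) (c_gt0 : 0 < c) :
  exists (c' : R) (n0 : nat) (eta : nat -> R),
    [/\ 0 < c',
        forall n, 0 <= eta n <= 1,
        eta n @[n --> \oo] --> (0 : R)
      & forall n Delta : nat, (n0 <= n)%N ->
          c * ln (n%:R : R) <= Delta%:R -> (Delta < n)%N ->
          ~~ odd (n * Delta) ->
          exists g : rel 'I_n,
            [/\ simple_graph g, regular_graph g Delta
              & forall (d d' : measure_display) (Omega : measurableType d)
                  (S : measurableType d') (P : probability Omega R)
                  (X : nat -> Omega -> 'I_n * 'I_n) (U : Omega -> S)
                  (alg : S -> seq ('I_n * 'I_n) -> bool),
                  measurable_fun setT U ->
                  iid_uniform_requests P (edge_set g) n X U ->
                  online_algorithm alg ->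
                  ((1 - eta n)%:E <= P [set w : Omega |
                    (c' * (ln (n%:R : R) / ln (Delta%:R : R)) `^ (3%:R^-1)
                     <= max_discrepancy R (alg (U w)) (fun t => X t w) n)%R])%E]].
Proof.
(* The minimum keeps [eta] in [0, 1]; where it equals 1 the claim is trivial. *)
pose eta n : R := Num.min 1 (8 / Num.sqrt n%:R).
(* The threshold ensures c ln n >= e, hence Delta >= e and ln Delta >= 1. *)
exists (Num.min (4^-1) (c / 128)), (Num.truncn (expR (expR 1 / c))).+1, eta; split.
- by rewrite lt_min invr_gt0 ltr0n divr_gt0.
- by move=> n; rewrite le_min ge_min lexx ler01 divr_ge0.
- rewrite -cvg_shiftS.
  have -> : [sequence eta n.+1]_n = (fun n => Num.min 1 (8 * Num.sqrt (harmonic n))).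
    by apply/funext => n; rewrite /eta /harmonic /= sqrtrV.
  have h : 8 * Num.sqrt (harmonic n) @[n --> \oo] --> (0 : R).
    rewrite -[X in _ --> X](mulr0 8) -[X in _ * X]sqrtr0.
    apply: cvgM; first exact: cvg_cst.
    have sc : {for (0 : R), continuous (@Num.sqrt R)} by exact: sqrt_continuous.
    exact: (continuous_cvg eventually_filter sc cvg_harmonic).
  apply: (squeeze_cvgr _ (cvg_cst 0) h).
  by near=> n; rewrite ge_min lexx orbT le_min ler01 mulr_ge0.
move=> [//|n] Delta n0n cD Dn ev.
have De : expR 1 <= Delta%:R :> R.
  apply: le_trans cD; rewrite mulrC -ler_pdivrMr // -[leLHS]expRK.
  rewrite ler_ln ?posrE ?expR_gt0 ?ltr0n //.
  by apply: le_trans (ltW (truncnS_gt _)) _; rewrite ler_nat.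
exists (circulant Delta); split.
- exact: circulant_simple.
- exact: circulant_regular.
move=> d d' Omega S P X U alg mU iid malg.
have [eta1|eta1] := leP 1 (8 / Num.sqrt n.+1%:R : R).
  by rewrite /eta min_l // subrr measure_ge0.
have [k yk avoid] := avoid_prob_le_sqrt c_gt0 De cD Dn ev (lexx _).
rewrite /eta min_r ?(ltW eta1) //.
apply: (prob_max_discrepancy_ge _ yk _ avoid) => //; last exact: ltW.
have := card_edge_set (circulant_simple n Delta) (circulant_regular Dn ev).
have : (0 < Delta)%N by rewrite -(ltr0n R) (lt_le_trans _ De) ?expR_gt0.
by lia.
Unshelve. all: by end_near. Qed.
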